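(* Let $\mathcal C$ be a finitely complete category and let $R$ be a relation on $\mathcal C$. Then $R$ is an $\mathrm{Id}$-presentation of a weak factorization system if and only if $R$ is a Moore relation system.
   Context: Conventions: finite limits are chosen; $(a,b)$ denotes the morphism into a product or pullback with components $a,b$; $A\,{}_{a}\!\times_{b}B$ is the pullback of $a:A\to Z$ and $b:B\to Z$. $\mathrm{LLP}(\mathsf D)$ is the class of morphisms with the left lifting property against all of $\mathsf D$. A relation $R$ on $\mathcal C$ consists, for each object $X$, of morphisms $\eta_X:X\to\Psi X$ and $\epsilon_{0X},\epsilon_{1X}:\Psi X\to X$ with $\epsilon_{iX}\eta_X=1_X$, and, for each $f:X\to Y$, of a chosen $\Psi f:\Psi X\to\Psi Y$ with $\epsilon_{iY}\Psi f=f\epsilon_{iX}$, $\Psi f\,\eta_X=\eta_Yf$ (functoriality not required). A factorization $F$ on $\mathcal C$ assigns to each $f:X\to Y$ morphisms $\lambda_Ff:X\to\Phi_Ff$, $\rho_Ff:\Phi_Ff\to Y$ with $\rho_Ff\,\lambda_Ff=f$, and to each commutative square $\langle\alpha,\beta\rangle:f\to g$ (so $g\alpha=\beta f$) a chosen $\Phi_F\langle\alpha,\beta\rangle:\Phi_Ff\to\Phi_Fg$ with $\Phi_F\langle\alpha,\beta\rangle\lambda_Ff=\lambda_Fg\,\alpha$, $\rho_Fg\,\Phi_F\langle\alpha,\beta\rangle=\beta\rho_Ff$ (functoriality not required). $\mathrm{coalg}(F)$ is the class of $f:X\to Y$ for which there is $s:Y\to\Phi_Ff$ with $sf=\lambda_Ff$,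 $\rho_Ff\,s=1_Y$; $\mathrm{alg}(F)$ is the class of $f:X\to Y$ for which there is $s:\Phi_Ff\to X$ with $s\lambda_Ff=1_X$, $fs=\rho_Ff$. $F$ is a weak factorization structure if $\lambda_Ff\in\mathrm{coalg}(F)$ and $\rho_Ff\in\mathrm{alg}(F)$ for all $f$; then $[F]=(\mathrm{coalg}(F),\mathrm{alg}(F))$ is a weak factorization system. For a relation $R$, $\mathbf F(R)$ is the factorization sending $f:X\to Y$ to $X\xrightarrow{(1_X,\eta_Yf)}X\,{}_{f}\!\times_{\epsilon_0}\Psi Y\xrightarrow{\epsilon_1\pi_{\Psi Y}}Y$ and $\langle\alpha,\beta\rangle$ to $\alpha\times\Psi\beta$. $R$ is an $\mathrm{Id}$-presentation (of the weak factorization system $[\mathbf F(R)]$) if $\mathbf F(R)$ is a weak factorization structure and, writing $\mathsf D=\mathrm{alg}(\mathbf F(R))$, for each object $X$: $(\epsilon_{0X},\epsilon_{1X}):\Psi X\to X\times X$ is in $\mathsf D$, and for every $\alpha:A\to X$ and $i=0,1$ the morphism $(1_A,\eta_X\alpha):A\to A\,{}_{\alpha}\!\times_{\epsilon_{i}}\Psi X$ is in $\mathrm{LLP}(\mathsf D)$. $R$ is a Moore relation system if it is transitive, homotopical and symmetric. Transitive: for each $X$ there is $\mu_X:\Psi X\,{}_{\epsilon_1}\!\times_{\epsilon_0}\Psi X\to\Psi X$ with $\epsilon_0\mu_X=\epsilon_0\pi_0$, $\epsilon_1\mu_X=\epsilon_1\pi_1$, $\mu_X(1,\eta\epsilon_1)=1_{\Psi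 X}$. Homotopical: for each $X$ there are an object $\Psi^{\square}X$ and morphisms $\eta^{\square}:X\to\Psi^{\square}X$, $\epsilon^{\square}_0,\epsilon^{\square}_1,\zeta:\Psi^{\square}X\to\Psi X$, $\delta_X:\Psi X\to\Psi^{\square}X$, and for each $f:X\to Y$ a morphism $\tau_f:X\,{}_{\eta f}\!\times_{\zeta}\Psi^{\square}Y\to\Psi(X\,{}_{f}\!\times_{\epsilon_0}\Psi Y)$, such that $\epsilon^{\square}_i\eta^{\square}=\eta$, $\zeta\eta^{\square}=\eta$, $\epsilon_0\epsilon^{\square}_i=\epsilon_i\zeta$, $\delta\eta=\eta^{\square}$, $\epsilon^{\square}_0\delta=\zeta\delta=\eta\epsilon_0$, $\epsilon^{\square}_1\delta=1_{\Psi X}$, $\tau_f(1_X,\eta^{\square}f)=\eta(1_X,\eta f)$, and $\epsilon_i\tau_f=1_X\times\epsilon^{\square}_i$ ($i=0,1$). Symmetric: for each $X$ there is $\nu_X:\Psi X\,{}_{\epsilon_0}\!\times_{\epsilon_0}\Psi X\to\Psi X$ with $\epsilon_0\nu_X=\epsilon_1\pi_0$, $\epsilon_1\nu_X=\epsilon_1\pi_1$, $\nu_X(\eta\epsilon_0,1)=1_{\Psi X}$. *)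

(* Defs.v *)
From mathcomp Require Import ssreflect ssrfun ssrbool.

Set Implicit Arguments.
Unset Strict Implicit.
Unset Printing Implicit Defensive.

Declare Scope cat_scope.
Delimit Scope cat_scope with cat.
Local Open Scope cat_scope.

Record category := Category {
  obj :> Type;
  hom : obj -> obj -> Type;
  idm : forall X, hom X X;
  comp : forall X Y Z, hom Y Z -> hom X Y -> hom X Z;
  compA : forall X Y Z W (h : hom Z W) (g : hom Y Z) (f : hom X Y),
    comp h (comp g f) = comp (comp h g) f;
  comp1m : forall X Y (f : hom X Y), comp (idm Y) f = f;
  compm1 : forall X Y (f : hom X Y), comp f (idm X) = f }.

Arguments hom {c} X Y.
Arguments idm {c} X.

(* Inside cat_scope this overrides ssrfun's composition of functions. *)
Notation "g \o f" := (comp g f) : cat_scope.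

(* Finite limits are given as a chosen terminal object, chosen binary products
   and chosen pullbacks; no compatibility between the choices is assumed. *)
Record finCompleteCategory := FinCompleteCategory {
  base_cat :> category;
  (* terminal object *)
  one : base_cat;
  to_one : forall X : base_cat, hom X one;
  to_one_uniq : forall (X : base_cat) (u v : hom X one), u = v;
  (* binary products *)
  prd : base_cat -> base_cat -> base_cat;
  pr1 : forall X Y, hom (prd X Y) X;
  pr2 : forall X Y, hom (prd X Y) Y;
  pair : forall W X Y, hom W X -> hom W Y -> hom W (prd X Y);
  pr1_pair : forall W X Y (u : hom W X) (v : hom W Y),
    pr1 X Y \o pair u v = u;
  pr2_pair : forall W X Y (u : hom W X) (v : hom W Y),
    pr2 X Y \o pair u v = v;
  pair_uniq : forall W X Y (m n : hom W (prd X Y)),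
    pr1 X Y \o m = pr1 X Y \o n -> pr2 X Y \o m = pr2 X Y \o n -> m = n;
  (* pullbacks *)
  pb : forall A B Z : base_cat, hom A Z -> hom B Z -> base_cat;
  pb1 : forall A B Z (a : hom A Z) (b : hom B Z), hom (pb a b) A;
  pb2 : forall A B Z (a : hom A Z) (b : hom B Z), hom (pb a b) B;
  pb_comm : forall A B Z (a : hom A Z) (b : hom B Z),
    a \o pb1 a b = b \o pb2 a b;
  pb_pair : forall A B Z (a : hom A Z) (b : hom B Z)
    W (u : hom W A) (v : hom W B), a \o u = b \o v -> hom W (pb a b);
  pb1_pair : forall A B Z (a : hom A Z) (b : hom B Z)
    W (u : hom W A) (v : hom W B) (e : a \o u = b \o v),
    pb1 a b \o pb_pair e = u;
  pb2_pair : forall A B Z (a : hom A Z) (b : hom B Z)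
    W (u : hom W A) (v : hom W B) (e : a \o u = b \o v),
    pb2 a b \o pb_pair e = v;
  pb_uniq : forall A B Z (a : hom A Z) (b : hom B Z) W (m n : hom W (pb a b)),
    pb1 a b \o m = pb1 a b \o n -> pb2 a b \o m = pb2 a b \o n -> m = n }.

(* The components of the pairing are repeated as explicit arguments, so that
   they can be read off from a term; they are determined by the type of e. *)
Definition pbpair (C : finCompleteCategory) (A B Z : C) (a : hom A Z)
    (b : hom B Z) (W : C) (u : hom W A) (v : hom W B) (e : a \o u = b \o v) :
  hom W (pb a b) := pb_pair e.
Arguments pbpair {C A B Z a b W} u v e.

(* The morphism h x k between pullbacks. *)
Definition pbmap (C : finCompleteCategory) (A B Z A' B' Z' : C)
    (a : hom A Z) (b : hom B Z) (a' : hom A' Z') (b' : hom B' Z')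
    (h : hom A A') (k : hom B B')
    (e : a' \o (h \o pb1 a b) = b' \o (k \o pb2 a b)) :
  hom (pb a b) (pb a' b') := pbpair (h \o pb1 a b) (k \o pb2 a b) e.
Arguments pbmap {C A B Z A' B' Z' a b a' b'} h k e.

Definition mor_class (C : category) := forall X Y : C, hom X Y -> Prop.

Definition lifts (C : category) (A B X Y : C) (l : hom A B) (r : hom X Y) :=
  forall (u : hom A X) (v : hom B Y), r \o u = v \o l ->
  exists d : hom B X, d \o l = u /\ r \o d = v.

Definition LLP (C : category) (D : mor_class C) : mor_class C :=
  fun A B l => forall (X Y : C) (r : hom X Y), D X Y r -> lifts l r.

Record factorization (C : category) := Factorization {
  mid : forall X Y : C, hom X Y -> C;
  lam : forall (X Y : C) (f : hom X Y), hom X (mid f);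
  rho : forall (X Y : C) (f : hom X Y), hom (mid f) Y;
  rho_lam : forall (X Y : C) (f : hom X Y), rho f \o lam f = f;
  midmap : forall (X Y X' Y' : C) (f : hom X Y) (g : hom X' Y')
    (alpha : hom X X') (beta : hom Y Y'),
    g \o alpha = beta \o f -> hom (mid f) (mid g);
  midmap_lam : forall (X Y X' Y' : C) (f : hom X Y) (g : hom X' Y')
    (alpha : hom X X') (beta : hom Y Y') (e : g \o alpha = beta \o f),
    midmap e \o lam f = lam g \o alpha;
  rho_midmap : forall (X Y X' Y' : C) (f : hom X Y) (g : hom X' Y')
    (alpha : hom X X') (beta : hom Y Y') (e : g \o alpha = beta \o f),
    rho g \o midmap e = beta \o rho f }.

Definition coalg (C : category) (F : factorization C) : mor_class C :=
  fun X Y f => exists s : hom Y (mid F f),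
    s \o f = lam F f /\ rho F f \o s = idm Y.

Definition alg (C : category) (F : factorization C) : mor_class C :=
  fun X Y f => exists s : hom (mid F f) X,
    s \o lam F f = idm X /\ f \o s = rho F f.

Definition weak_factorization_structure (C : category) (F : factorization C) :=
  forall (X Y : C) (f : hom X Y), coalg F (lam F f) /\ alg F (rho F f).

(* The index i of epsilon_i is a boolean: false stands for 0, true for 1. *)
Record relation_on (C : category) := RelationOn {
  Psi : C -> C;
  eta : forall X, hom X (Psi X);
  eps : forall (i : bool) X, hom (Psi X) X;
  eps_eta : forall i X, eps i X \o eta X = idm X;
  Psimap : forall X Y : C, hom X Y -> hom (Psi X) (Psi Y);
  eps_Psimap : forall i (X Y : C) (f : hom X Y),
    eps i Y \o Psimap f = f \o eps i X;
  Psimap_eta : forall (X Y : C) (f : hom X Y),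
    Psimap f \o eta X = eta Y \o f }.

Notation eps0 R X := (eps R false X).
Notation eps1 R X := (eps R true X).

Section FactorizationOfRelation.
Context (C : finCompleteCategory) (R : relation_on C).

Lemma unit_pair_comm (i : bool) (A X : C) (a : hom A X) :
  a \o idm A = eps R i X \o (eta R X \o a).
Proof. by rewrite compA eps_eta comp1m compm1. Qed.

(* (1_A, eta a) : A -> A x_{a, eps_i} Psi X *)
Definition unit_pair (i : bool) (A X : C) (a : hom A X) :
  hom A (pb a (eps R i X)) :=
  pbpair (idm A) (eta R X \o a) (unit_pair_comm i a).

Definition Frho (X Y : C) (f : hom X Y) : hom (pb f (eps0 R Y)) Y :=
  eps1 R Y \o pb2 f (eps0 R Y).

Lemma Frho_unit_pair (X Y : C) (f : hom X Y) :
  Frho f \o unit_pair false f = f.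
Proof. by rewrite /Frho -compA pb2_pair compA eps_eta comp1m. Qed.

Lemma Fmid_comm (X Y X' Y' : C) (f : hom X Y) (g : hom X' Y')
    (alpha : hom X X') (beta : hom Y Y') (e : g \o alpha = beta \o f) :
  g \o (alpha \o pb1 f (eps0 R Y)) =
  eps0 R Y' \o (Psimap R beta \o pb2 f (eps0 R Y)).
Proof. by rewrite !compA e eps_Psimap -!compA pb_comm. Qed.

Definition Fmidmap (X Y X' Y' : C) (f : hom X Y) (g : hom X' Y')
    (alpha : hom X X') (beta : hom Y Y') (e : g \o alpha = beta \o f) :
  hom (pb f (eps0 R Y)) (pb g (eps0 R Y')) :=
  pbmap alpha (Psimap R beta) (Fmid_comm e).

Lemma Fmidmap_unit_pair (X Y X' Y' : C) (f : hom X Y) (g : hom X' Y')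
    (alpha : hom X X') (beta : hom Y Y') (e : g \o alpha = beta \o f) :
  Fmidmap e \o unit_pair false f = unit_pair false g \o alpha.
Proof.
apply: pb_uniq; rewrite !compA ?pb1_pair ?pb2_pair -compA ?pb1_pair ?pb2_pair.
  by rewrite compm1 comp1m.
by rewrite compA Psimap_eta -!compA e.
Qed.

Lemma Frho_midmap (X Y X' Y' : C) (f : hom X Y) (g : hom X' Y')
    (alpha : hom X X') (beta : hom Y Y') (e : g \o alpha = beta \o f) :
  Frho g \o Fmidmap e = beta \o Frho f.
Proof. by rewrite /Frho -compA pb2_pair !compA eps_Psimap. Qed.

Definition FR : factorization C :=
  @Factorization C (fun X Y f => pb f (eps0 R Y))
    (fun X Y f => unit_pair false f) Frho Frho_unit_pair
    Fmidmap Fmidmap_unit_pair Frho_midmap.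

End FactorizationOfRelation.

Definition Id_presentation (C : finCompleteCategory) (R : relation_on C) :=
  weak_factorization_structure (FR R) /\
  forall X : C,
    alg (FR R) (pair (eps0 R X) (eps1 R X)) /\
    forall (A : C) (a : hom A X) (i : bool),
      LLP (alg (FR R)) (unit_pair R i a).

Section MooreRelationSystem.
Context (C : finCompleteCategory) (R : relation_on C).

Lemma trans_unit_comm (X : C) :
  eps1 R X \o idm (Psi R X) = eps0 R X \o (eta R X \o eps1 R X).
Proof. exact: unit_pair_comm. Qed.

Definition transitive_relation :=
  forall X : C, exists mu : hom (pb (eps1 R X) (eps0 R X)) (Psi R X),
    [/\ eps0 R X \o mu = eps0 R X \o pb1 (eps1 R X) (eps0 R X),
        eps1 R X \o mu = eps1 R X \o pb2 (eps1 R X) (eps0 R X) &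
        mu \o pbpair (idm (Psi R X)) (eta R X \o eps1 R X) (trans_unit_comm X)
          = idm (Psi R X)].

Lemma sym_unit_comm (X : C) :
  eps0 R X \o (eta R X \o eps0 R X) = eps0 R X \o idm (Psi R X).
Proof. by rewrite -unit_pair_comm. Qed.

Definition symmetric_relation :=
  forall X : C, exists nu : hom (pb (eps0 R X) (eps0 R X)) (Psi R X),
    [/\ eps0 R X \o nu = eps1 R X \o pb1 (eps0 R X) (eps0 R X),
        eps1 R X \o nu = eps1 R X \o pb2 (eps0 R X) (eps0 R X) &
        nu \o pbpair (eta R X \o eps0 R X) (idm (Psi R X)) (sym_unit_comm X)
          = idm (Psi R X)].

(* The part of a homotopical structure that lives over a single object X. *)
Record square_data (X : C) := SquareData {
  Psq : C;
  etasq : hom X Psq;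
  epssq : forall i : bool, hom Psq (Psi R X);
  zeta : hom Psq (Psi R X);
  delta : hom (Psi R X) Psq;
  epssq_etasq : forall i, epssq i \o etasq = eta R X;
  zeta_etasq : zeta \o etasq = eta R X;
  eps0_epssq : forall i, eps0 R X \o epssq i = eps R i X \o zeta;
  delta_eta : delta \o eta R X = etasq;
  epssq0_delta : epssq false \o delta = eta R X \o eps0 R X;
  zeta_delta : zeta \o delta = eta R X \o eps0 R X;
  epssq1_delta : epssq true \o delta = idm (Psi R X) }.

Lemma tau_unit_comm (X Y : C) (S : square_data Y) (f : hom X Y) :
  (eta R Y \o f) \o idm X = zeta S \o (etasq S \o f).
Proof. by rewrite compm1 compA zeta_etasq. Qed.

Lemma tau_eps_comm (X Y : C) (S : square_data Y) (f : hom X Y) (i : bool) :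
  f \o (idm X \o pb1 (eta R Y \o f) (zeta S)) =
  eps0 R Y \o (epssq S i \o pb2 (eta R Y \o f) (zeta S)).
Proof.
rewrite comp1m compA eps0_epssq -compA -pb_comm !compA.
by rewrite eps_eta comp1m.
Qed.

(* tau_f only involves the square data of the codomain of f. *)
Definition homotopical_relation :=
  forall Y : C, exists S : square_data Y,
  forall (X : C) (f : hom X Y),
  exists tau : hom (pb (eta R Y \o f) (zeta S)) (Psi R (pb f (eps0 R Y))),
    tau \o pbpair (idm X) (etasq S \o f) (tau_unit_comm S f)
      = eta R (pb f (eps0 R Y)) \o unit_pair R false f /\
    forall i : bool,
      eps R i (pb f (eps0 R Y)) \o tau
        = pbmap (idm X) (epssq S i) (tau_eps_comm S f i).

Definition Moore_relation_system :=
  [/\ transitive_relation, homotopical_relation & symmetric_relation].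

End MooreRelationSystem.

(* Main.v *)
(** Both conditions are equivalent to a third one: F(R) is a weak factorization
    structure and each (eps0, eps1) : Psi X -> X x X is in D = alg(F(R)).  A
    Moore relation system gives this by explicit formulas: the homotopy tau
    contracts the mapping path object, transitivity composes paths, and
    composition on both ends transports along Psi X -> X x X.  Conversely,
    lifting against (eps0, eps1) yields transitivity, symmetry and path reversal, hence
    the Frobenius property: L = LLP(D) is stable under pullback along D.  As
    every map factors as one in L followed by one in D, a section in L of a map
    in D then stays in L after pullback along an arbitrary map.  Applied to eta
    this gives both unit conditions of an Id-presentation; applied to the unit
    of a slicewise path object of eps0 : Psi Y -> Y it gives the homotopical
    structure. *)

From mathcomp Require Import ssreflect ssrfun ssrbool.
Require Import Defs.

Set Implicit Arguments.
Unset Strict Implicit.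
Unset Printing Implicit Defensive.

Local Open Scope cat_scope.

Lemma reassoc (C : category) (X Y Z : C) (b : hom Y Z) (a : hom X Y) c
    (e : b \o a = c) (W : C) (w : hom W X) : b \o (a \o w) = c \o w.
Proof. by rewrite compA e. Qed.

(** * Pullback squares and pairings *)

Section Pullbacks.
Context (C : finCompleteCategory).

(** A predicate besides the chosen [pb]: the domain of [tau] will be recognized as a pullback of a
    cospan other than the one it was chosen for. *)
Definition is_pullback (A B Z P : C) (a : hom A Z) (b : hom B Z)
    (p : hom P A) (q : hom P B) :=
  [/\ a \o p = b \o q,
      forall (W : C) (u : hom W A) (v : hom W B), a \o u = b \o v ->
        exists m : hom W P, p \o m = u /\ q \o m = v &
      forall (W : C) (m n : hom W P),
        p \o m = p \o n -> q \o m = q \o n -> m = n].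

Lemma pb_is_pullback (A B Z : C) (a : hom A Z) (b : hom B Z) :
  is_pullback a b (pb1 a b) (pb2 a b).
Proof.
split; [exact: pb_comm | | by move=> W m n; apply: pb_uniq].
by move=> W u v e; exists (pbpair u v e); rewrite pb1_pair pb2_pair.
Qed.

Lemma is_pullback_sym (A B Z P : C) (a : hom A Z) (b : hom B Z)
    (p : hom P A) (q : hom P B) : is_pullback a b p q -> is_pullback b a q p.
Proof.
case=> sq ex un; split=> // [W u v e|W m n e1 e2]; last exact: un.
by have [m []] := ex _ _ _ (esym e); exists m.
Qed.

(** Meant for [m] the unit [eta], which is split by [eps0]. *)
Lemma is_pullback_retract (A B Z Z' P : C) (a : hom A Z) (b : hom B Z)
    (p : hom P A) (q : hom P B) (m : hom Z Z') (r : hom Z' Z) :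
  r \o m = idm Z -> is_pullback (m \o a) (m \o b) p q -> is_pullback a b p q.
Proof.
move=> rm [sq ex un]; split=> // [|W u v e].
  rewrite -[LHS]comp1m -[RHS]comp1m -rm -!compA.
  by rewrite (compA m) sq -!compA.
by apply: ex; rewrite -!compA e.
Qed.

Lemma pb1_pbpair (A B Z W : C) (a : hom A Z) (b : hom B Z)
    (u : hom W A) (v : hom W B) (e : a \o u = b \o v) :
  pb1 a b \o pbpair u v e = u.
Proof. exact: pb1_pair. Qed.

Lemma pb2_pbpair (A B Z W : C) (a : hom A Z) (b : hom B Z)
    (u : hom W A) (v : hom W B) (e : a \o u = b \o v) :
  pb2 a b \o pbpair u v e = v.
Proof. exact: pb2_pair. Qed.

Lemma pb1_pbpairA (A B Z W V : C) (a : hom A Z) (b : hom B Z)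
    (u : hom W A) (v : hom W B) (e : a \o u = b \o v) (w : hom V W) :
  pb1 a b \o (pbpair u v e \o w) = u \o w.
Proof. exact/reassoc/pb1_pbpair. Qed.

Lemma pb2_pbpairA (A B Z W V : C) (a : hom A Z) (b : hom B Z)
    (u : hom W A) (v : hom W B) (e : a \o u = b \o v) (w : hom V W) :
  pb2 a b \o (pbpair u v e \o w) = v \o w.
Proof. exact/reassoc/pb2_pbpair. Qed.

Lemma pairC (V W X Y : C) (u : hom W X) (v : hom W Y) (w : hom V W) :
  pair u v \o w = pair (u \o w) (v \o w).
Proof.
by apply: pair_uniq; rewrite ?(reassoc (pr1_pair _ _)) ?pr1_pair
  ?(reassoc (pr2_pair _ _)) ?pr2_pair.
Qed.

Lemma pair_inj (W X Y : C) (u u' : hom W X) (v v' : hom W Y) :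
  pair u v = pair u' v' -> u = u' /\ v = v'.
Proof.
move=> e; split.
  by rewrite -(pr1_pair u v) e pr1_pair.
by rewrite -(pr2_pair u v) e pr2_pair.
Qed.

End Pullbacks.

Definition pbE :=
  (pb1_pbpair, pb2_pbpair, pb1_pbpairA, pb2_pbpairA, comp1m, compm1).

(** * Algebras, coalgebras and lifting for F(R) *)

Section Relation.
Context (C : finCompleteCategory) (R : relation_on C).
Local Notation eta := (eta R _).
Local Notation eps i := (eps R i _).
Local Notation Psimap := (Psimap R).
Local Notation D := (@alg C (FR R) _ _).
Local Notation L := (@LLP C (alg (FR R)) _ _).

(* A coalgebra structure on f exhibits X as a strong deformation retract of Y:
   r is the retraction, h the homotopy from f r to the identity. *)
Lemma coalgP (X Y : C) (f : hom X Y) : coalg (FR R) f <->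
  exists (r : hom Y X) (h : hom Y (Psi R Y)),
    [/\ r \o f = idm X, h \o f = eta \o f,
        eps false \o h = f \o r & eps true \o h = idm Y].
Proof.
split=> [[/= s [sf rs]]|[r [h [rf hf h0 h1]]]].
  exists (pb1 _ _ \o s), (pb2 _ _ \o s).
  rewrite -!compA sf /unit_pair !pbE; split=> //.
    by rewrite (reassoc (esym (pb_comm _ _))) -compA.
  by rewrite compA.
exists (pbpair r h (esym h0)); split=> /=.
  by apply: pb_uniq; rewrite /unit_pair !pbE.
by rewrite /Frho -compA !pbE.
Qed.

Lemma algP (X Y : C) (f : hom X Y) : D f <->
  exists t : hom (pb f (eps false)) X,
    t \o unit_pair R false f = idm X /\
    f \o t = eps true \o pb2 f (eps false).
Proof. by []. Qed.

Lemma coalg_LLP (X Y : C) (f : hom X Y) : coalg (FR R) f -> L f.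
Proof.
move=> [s [sf rs]] A B g [t [tl gt]] u v e.
exists (t \o (midmap (FR R) e \o s)); split.
  by rewrite -!compA sf midmap_lam (reassoc tl) comp1m.
by rewrite (reassoc gt) (reassoc (rho_midmap (FR R) e)) -compA rs compm1.
Qed.

Lemma LLP_comp (X Y Z : C) (g : hom Y Z) (f : hom X Y) :
  L g -> L f -> L (g \o f).
Proof.
move=> Lg Lf A B r Dr u v e.
have [|d [df rd]] := Lf _ _ _ Dr u (v \o g); first by rewrite -compA.
have [d' [d'g rd']] := Lg _ _ _ Dr d v rd.
by exists d'; rewrite compA d'g.
Qed.

(** [g] and [r] exhibit [f] as a retract of [g \o f]. *)
Lemma LLP_cancel_retract (X Y Z : C) (g : hom Y Z) (f : hom X Y) (r : hom Z Y) :
  r \o g = idm Y -> L (g \o f) -> L f.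
Proof.
move=> rg Lgf A B p Dp u v e.
have [|d [dgf pd]] := Lgf _ _ _ Dp u (v \o r).
  by rewrite e -compA (reassoc rg) comp1m.
by exists (d \o g); rewrite -compA dgf compA pd -compA rg compm1.
Qed.

Lemma pr1_alg (X Y : C) : D (pr1 X Y).
Proof.
apply/algP.
exists (pair (eps true \o pb2 _ _) (pr2 X Y \o pb1 _ _)); rewrite pr1_pair.
split=> //; rewrite pairC -!compA /unit_pair !pbE.
apply: pair_uniq; rewrite ?pr1_pair ?pr2_pair compm1 //.
by rewrite (reassoc (eps_eta _ _ _)) comp1m.
Qed.

Lemma pr2_alg (X Y : C) : D (pr2 X Y).
Proof.
apply/algP.
exists (pair (pr1 X Y \o pb1 _ _) (eps true \o pb2 _ _)); rewrite pr2_pair.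
split=> //; rewrite pairC -!compA /unit_pair !pbE.
apply: pair_uniq; rewrite ?pr1_pair ?pr2_pair compm1 //.
by rewrite (reassoc (eps_eta _ _ _)) comp1m.
Qed.

(** * Path operations obtained by lifting *)

Section WeakFactorization.
Hypothesis wfs : weak_factorization_structure (FR R).
Hypothesis endpoints_alg : forall X : C,
  D (pair (Defs.eps R false X) (Defs.eps R true X)).

Lemma unit_pair0_LLP (X Y : C) (f : hom X Y) : L (unit_pair R false f).
Proof. by apply: coalg_LLP; case: (wfs f). Qed.
Arguments unit_pair0_LLP {X Y} f _ _ _ _.

(** Retract argument: a filler of [f] against [rho f], with [lam f] on top, is a coalgebra
    structure. *)
Lemma LLP_coalg (X Y : C) (f : hom X Y) : L f -> coalg (FR R) f.
Proof.
move=> Lf; have [_ Dr] := wfs f.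
have [|d [df rd]] := Lf _ _ _ Dr (lam _ f) (idm Y); last by exists d.
by rewrite rho_lam comp1m.
Qed.

Lemma alg_of_lifts (X Y : C) (f : hom X Y) :
  (forall (A B : C) (l : hom A B), L l -> lifts l f) -> D f.
Proof.
move=> lift_f.
have [|d [dl fd]] := lift_f _ _ _ (unit_pair0_LLP f) (idm X) (rho (FR R) f).
  by rewrite (rho_lam (FR R)) compm1.
by exists d.
Qed.

Lemma alg_comp (X Y Z : C) (g : hom Y Z) (f : hom X Y) :
  D g -> D f -> D (g \o f).
Proof.
move=> Dg Df; apply: alg_of_lifts => A B l Ll u v e.
have [|d [dl gd]] := Ll _ _ _ Dg (f \o u) v; first by rewrite compA.
have [d' [d'l fd']] := Ll _ _ _ Df u d (esym dl).
by exists d'; rewrite -compA fd'.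
Qed.

Lemma alg_pullback (A B Z P : C) (a : hom A Z) (b : hom B Z)
    (p : hom P A) (q : hom P B) : is_pullback a b p q -> D a -> D q.
Proof.
move=> [sq ex un] Da; apply: alg_of_lifts => U V l Ll u v e.
have [|d [dl ad]] := Ll _ _ _ Da (p \o u) (b \o v).
  by rewrite compA sq -compA e compA.
have [m [pm qm]] := ex _ _ _ ad.
by exists m; split=> //; apply: un; rewrite compA ?pm ?qm.
Qed.

Lemma eps_alg i (X : C) : D (Defs.eps R i X).
Proof.
case: i.
  rewrite -(pr2_pair (Defs.eps R false X) (Defs.eps R true X)).
  exact/alg_comp/endpoints_alg/pr2_alg.
rewrite -(pr1_pair (Defs.eps R false X) (Defs.eps R true X)).
exact/alg_comp/endpoints_alg/pr1_alg.
Qed.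

Lemma wfs_factor (X Y : C) (f : hom X Y) :
  exists (S : C) (l : hom X S) (r : hom S Y), [/\ L l, D r & r \o l = f].
Proof.
exists (mid (FR R) f), (lam _ f), (rho _ f).
by split; [exact: unit_pair0_LLP | case: (wfs f) | rewrite rho_lam].
Qed.

(** Lifting against (eps0, eps1). This produces [mu], [nu], path reversal and [tau] below. *)
Lemma path_lift (A B X : C) (l : hom A B) (p : hom A (Psi R X))
    (u v : hom B X) : L l ->
  eps false \o p = u \o l -> eps true \o p = v \o l ->
  exists h : hom B (Psi R X),
    [/\ h \o l = p, eps false \o h = u & eps true \o h = v].
Proof.
move=> Ll e0 e1.
have [|d [dl]] := Ll _ _ _ (endpoints_alg X) p (pair u v).
  by rewrite !pairC e0 e1.
by rewrite pairC => /pair_inj [d0 d1]; exists d.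
Qed.

(** Followed by the section (eps0, 1) of [pb2], [eta] becomes the left factor of the identity; the
    section is then cancelled. *)
Lemma eta_LLP (X : C) : L (Defs.eta R X).
Proof.
apply: (@LLP_cancel_retract _ _ _
  (pbpair (eps false) (idm _) (etrans (comp1m _) (esym (compm1 _))))
  _ (pb2 (idm X) (eps false))); first by rewrite !pbE.
suff -> : pbpair (eps false) (idm _) (etrans (comp1m _) (esym (compm1 _)))
    \o eta = unit_pair R false (idm X) by exact: unit_pair0_LLP.
by apply: pb_uniq; rewrite /unit_pair !pbE // eps_eta.
Qed.

(** The domain of [mu] is the mapping path object of [eps1], so the identity of [Psi X] extends
    along its unit. *)
Lemma transitive_of_wfs : transitive_relation R.
Proof.
move=> X.
have [||mu [m1 m0 m2]] := path_lift (p := idm _)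
   (u := eps false \o pb1 _ _) (v := eps true \o pb2 _ _)
   (unit_pair0_LLP (Defs.eps R true X)).
- by rewrite -!compA /unit_pair !pbE.
- by rewrite -!compA /unit_pair !pbE (reassoc (eps_eta _ _ _)) !pbE.
by exists mu; split=> //; rewrite -[RHS]m1; congr (_ \o _); apply: pb_uniq;
  rewrite /unit_pair !pbE.
Qed.

Lemma symmetric_of_wfs : symmetric_relation R.
Proof.
move=> X; set e := Defs.eps R false X.
have [||nu [m1 m0 m2]] := path_lift (p := idm _)
   (u := eps true \o pb2 _ _) (v := eps true \o pb1 _ _)
   (unit_pair0_LLP e).
- by rewrite -!compA /unit_pair !pbE (reassoc (eps_eta _ _ _)) !pbE.
- by rewrite -!compA /unit_pair !pbE.
(* The swap is needed because [unit_pair] has the constant path second, the unit law of [nu]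
   first. *)
exists (nu \o pbpair (pb2 e e) (pb1 e e) (esym (pb_comm _ _))).
rewrite !compA m0 m2 -!compA !pbE; split=> //.
rewrite -[RHS]m1; congr (_ \o _); apply: pb_uniq; rewrite /unit_pair !pbE //.
Qed.

(** * The Frobenius property and base change of sections *)

Lemma path_reversal (X : C) : exists i : hom (Psi R X) (Psi R X),
  [/\ eps false \o i = eps true, eps true \o i = eps false & i \o eta = eta].
Proof.
have [||i [i1 i2 i3]] := path_lift (p := eta) (u := eps true) (v := eps false)
   (@eta_LLP X); rewrite ?eps_eta //; by exists i.
Qed.

(* Transport along the reversed homotopy moves Z into the fibre over X, and the
   reversed lift of that homotopy is the new deformation. *)
Lemma Frobenius (X Y Z P : C) (f : hom X Y) (g : hom Z Y)
    (p : hom P X) (f' : hom P Z) :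
  is_pullback f g p f' -> L f -> D g -> L f'.
Proof.
move=> [sq ex un] /LLP_coalg/coalgP[r [h [rf hf h0 h1]]] /algP[t [tl gt]].
(* [s] contracts the mapping path object of [g] to the constant paths, which it keeps fixed. *)
have [||s [sl s0 s1]] := path_lift (p := eta \o unit_pair R false g)
   (u := unit_pair R false g \o pb1 _ _) (v := idm _) (unit_pair0_LLP g).
- by rewrite (reassoc (eps_eta _ _ _)) -compA !pbE.
- by rewrite (reassoc (eps_eta _ _ _)).
have [iY [iY0 iY1 iYeta]] := path_reversal Y.
have [iZ [iZ0 iZ1 iZeta]] := path_reversal Z.
have em : g \o idm Z = eps false \o (iY \o (h \o g)).
  by rewrite (reassoc iY0) (reassoc h1) !pbE.
set m := pbpair (idm Z) _ em.
(* Over the image of [f] the homotopy [h] is constant, so nothing is moved there. *)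
have mf' : m \o f' = unit_pair R false g \o f'.
  apply: pb_uniq; rewrite /unit_pair !pbE // -!compA -sq.
  by rewrite (reassoc hf) -!compA (reassoc iYeta).
have ez : f \o (r \o g) = g \o (t \o m).
  by rewrite (reassoc gt) -compA !pbE (reassoc iY1) (reassoc h0) compA.
have [d [pd f'd]] := ex _ _ _ ez.
apply/coalg_LLP/coalgP; exists d, (iZ \o (Psimap t \o (s \o m))); split.
- apply: un; rewrite compm1.
    by rewrite (reassoc pd) -compA -sq (reassoc rf) comp1m.
  by rewrite (reassoc f'd) -compA mf' (reassoc tl) comp1m.
- rewrite -!compA mf' (reassoc sl) -compA (reassoc (Psimap_eta _ _)) -compA.
  by rewrite (reassoc tl) comp1m (reassoc iZeta).
- rewrite (reassoc iZ0) (reassoc (eps_Psimap _ _ _)) -compA (reassoc s1).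
  by rewrite comp1m f'd.
rewrite (reassoc iZ1) (reassoc (eps_Psimap _ _ _)) -compA (reassoc s0) -!compA.
by rewrite (reassoc tl) comp1m !pbE.
Qed.

(* Factor f as r l with l in L and r in D. By Frobenius the pullback kQ of k
   along r and the pullback j of l along a map in D are in L; since j k' = kQ l
   and j has a retraction, k' is in L. *)
Lemma section_base_change (X Y E P : C) (f : hom X Y) (e : hom E Y)
    (k : hom Y E) (q1 : hom P X) (q2 : hom P E) (k' : hom X P) :
  is_pullback f e q1 q2 -> L k -> D e -> e \o k = idm Y ->
  q1 \o k' = idm X -> q2 \o k' = k \o f -> L k'.
Proof.
move=> pbP Lk De ek q1k' q2k'; have [sq ex un] := pbP.
pose r : hom (pb f (eps false)) Y := Frho R f.
pose l : hom X (pb f (eps false)) := unit_pair R false f.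
have rl : r \o l = f by exact: Frho_unit_pair.
have Dr : D r by case: (wfs f).
have Ll : L l := unit_pair0_LLP f.
have eK : r \o idm _ = e \o (k \o r) by rewrite (reassoc ek) !pbE.
pose kQ := pbpair _ _ eK.
have LkQ : L kQ.
  (* Frobenius is applied along [pb2 r e], the base change of [r]; that the square is a pullback
     uses [e \o k = idm Y]. *)
  apply: (@Frobenius _ _ _ _ k (pb2 r e) r kQ) => //; last first.
    exact: alg_pullback (pb_is_pullback r e) Dr.
  split; first by rewrite !pbE.
    move=> W u v kuv; exists (pb1 _ _ \o v).
    have uE : u = r \o (pb1 r e \o v).
      by rewrite (reassoc (pb_comm _ _)) -compA -kuv (reassoc ek) comp1m.
    by split=> //; apply: pb_uniq; rewrite !pbE // -compA -uE.
  move=> W m n _ /(congr1 (comp (pb1 _ _))).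
  by rewrite !pbE.
have eJ : r \o (l \o q1) = e \o q2 by rewrite (reassoc rl).
pose j := pbpair _ _ eJ.
have pbJ : is_pullback l (pb1 r e) q1 j.
  split; first by rewrite !pbE.
    move=> W u v luv.
    have [|m [m1 m2]] := ex _ u (pb2 r e \o v).
      by rewrite (reassoc (esym (pb_comm _ _))) -compA -luv (reassoc rl).
    by exists m; split=> //; apply: pb_uniq; rewrite !pbE // -compA m1.
  move=> W m n e1 /(congr1 (comp (pb2 _ _))).
  by rewrite !pbE => /(un _ _ _ e1).
have Dpb1 : D (pb1 r e).
  exact: alg_pullback (is_pullback_sym (pb_is_pullback r e)) De.
have Dq1 : D q1 := alg_pullback (is_pullback_sym pbP) De.
have Lj : L j := Frobenius pbJ Ll Dpb1.
have jk' : j \o k' = kQ \o l.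
  apply: pb_uniq; rewrite !pbE; first by rewrite -compA q1k' compm1.
  by rewrite q2k' -compA rl.
(* The retraction of [j] is a filler against [q1], with the identity of [P] on top. *)
have [|d [dj _]] := Lj _ _ _ Dq1 (idm _) (pb1 f (eps false) \o pb1 r e).
  by rewrite compm1 -compA !pbE.
apply: LLP_cancel_retract dj _.
by rewrite jk'; apply: LLP_comp.
Qed.

(** This is the base change along [a] of the section [eta] of [eps i]. *)
Lemma unit_pair_LLP i (A X : C) (a : hom A X) : L (unit_pair R i a).
Proof.
apply: (section_base_change (pb_is_pullback a (eps i)) (@eta_LLP X)).
- exact: eps_alg.
- exact: eps_eta.
- by rewrite /unit_pair !pbE.
by rewrite /unit_pair !pbE.
Qed.

(* The square object is a path object of eps0 : Psi Y -> Y in the slice over Y;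
   its squares have a constant zeta-side. *)
Lemma square_data_of_wfs (Y : C) :
  exists (Q : square_data R Y) (b : hom (Psq Q) Y),
  [/\ zeta Q = eta \o b, b \o etasq Q = idm Y, D b & L (etasq Q)].
Proof.
set e := Defs.eps R false Y.
(* The diagonal of [eps0]: its middle object [S] consists of homotopies between paths with a common
   start, given by [b]. *)
pose dg := pbpair (idm _) (idm _) (erefl (e \o idm _)).
have [S [ld [rd [Lld Drd rdld]]]] := wfs_factor dg.
pose b := e \o (pb1 e e \o rd).
have bE : b = e \o (pb2 e e \o rd) by rewrite /b (reassoc (pb_comm _ _)) compA.
have Db : D b.
  apply: alg_comp; [exact: eps_alg | apply: alg_comp => //].
  exact/(alg_pullback (is_pullback_sym (pb_is_pullback e e)))/eps_alg.
have bld : b \o ld = e by rewrite /b -!compA rdld !pbE.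
have eD : e \o (eta \o e) = e \o idm _.
  by rewrite (reassoc (eps_eta _ _ _)) !pbE.
(* [d], the future [delta], joins the constant path at the start to the given path; on constant
   paths these agree. *)
have [|d [deta rdd]] := @eta_LLP Y _ _ _ Drd (ld \o eta) (pbpair _ _ eD).
  rewrite compA rdld; apply: pb_uniq; rewrite !pbE // -compA.
  by rewrite eps_eta compm1.
have bd : b \o d = e.
  by rewrite /b -!compA rdd !pbE (reassoc (eps_eta _ _ _)) comp1m.
unshelve eexists (@SquareData C R Y S (ld \o eta)
  (fun i => (if i then pb2 e e else pb1 e e) \o rd) (eta \o b) d
  _ _ _ _ _ _ _).
- by move=> i; rewrite -compA (reassoc rdld) /dg; case: i; rewrite !pbE.
- by rewrite -compA (reassoc bld) eps_eta compm1.
- move=> i; rewrite (reassoc (eps_eta _ _ _)) comp1m.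
  by case: i; rewrite -?bE.
- exact: deta.
- by rewrite /= -compA rdd !pbE.
- by rewrite -compA bd.
- by rewrite /= -compA rdd !pbE.
exists b; split=> //=; first by rewrite (reassoc bld) eps_eta.
exact: LLP_comp Lld (@eta_LLP Y).
Qed.

Lemma homotopical_of_wfs : homotopical_relation R.
Proof.
move=> Y; have [Q [b [zE bQ Db LQ]]] := square_data_of_wfs Y.
exists Q => X f.
(* Since [zeta] is [eta \o b], cancelling [eta] presents the domain of [tau] as a base change of
   [b]. *)
have pbT : is_pullback f b (pb1 (eta \o f) (zeta Q)) (pb2 (eta \o f) (zeta Q)).
  apply: (is_pullback_retract (eps_eta R false Y)).
  by rewrite -zE; apply: pb_is_pullback.
set x := pbpair _ _ _.
have Lx : L x.
  by apply: section_base_change pbT LQ Db bQ _ _; rewrite !pbE.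
have x_end i : eps i \o (eta \o unit_pair R false f) =
    pbmap _ _ (tau_eps_comm Q f i) \o x.
  rewrite (reassoc (eps_eta _ _ _)).
  apply: pb_uniq; rewrite /unit_pair /pbmap /x !pbE // -!compA.
  by rewrite !pbE (reassoc (epssq_etasq Q i)).
have [t [tx t0 t1]] := path_lift Lx (x_end false) (x_end true).
by exists t; split=> // -[].
Qed.

End WeakFactorization.

(** * From a Moore relation system to lifting structure *)

Lemma wfs_of_Moore :
  Moore_relation_system R -> weak_factorization_structure (FR R).
Proof.
move=> [tr ho _] X Y f; split.
  have [S /(_ X f) [tau [tau_unit tau_eps]]] := ho Y.
  apply/coalgP; exists (pb1 _ _).
  (* [delta] grows each path from the constant one; [tau] turns this into the deformation onto
     [X]. *)
  have e : (eta \o f) \o pb1 f (eps false) =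
      zeta S \o (delta S \o pb2 f (eps false)).
    by rewrite (reassoc (zeta_delta S)) -!compA pb_comm.
  exists (tau \o pbpair _ _ e); split.
  - by rewrite /= /unit_pair !pbE.
  - rewrite -tau_unit -compA; congr (_ \o _).
    apply: pb_uniq; rewrite /= /unit_pair !pbE // -!compA.
    by rewrite !pbE (reassoc (delta_eta S)).
  - rewrite (reassoc (tau_eps _)).
    apply: pb_uniq; rewrite /= /unit_pair /pbmap !pbE // -!compA !pbE.
    by rewrite (reassoc (epssq0_delta S)) -!compA pb_comm.
  rewrite (reassoc (tau_eps _)).
  apply: pb_uniq; rewrite /= /unit_pair /pbmap !pbE // -!compA !pbE.
  by rewrite (reassoc (epssq1_delta S)) comp1m.
have [mu [mu0 mu1 mu_unit]] := tr Y.
(* The algebra structure on [Frho R f] appends the second path to the first by [mu]. *)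
have e : eps true \o (pb2 f (eps false) \o pb1 (Frho R f) (eps false)) =
    eps false \o pb2 (Frho R f) (eps false).
  by rewrite -pb_comm /Frho compA.
have e' : f \o (pb1 f (eps false) \o pb1 (Frho R f) (eps false)) =
    eps false \o (mu \o pbpair _ _ e).
  by rewrite (reassoc mu0) -compA !pbE !compA pb_comm.
apply/algP; exists (pbpair _ _ e'); split.
  apply: pb_uniq; rewrite !pbE -!compA /unit_pair ?pbE //.
  rewrite -[RHS]comp1m -mu_unit -compA; congr (_ \o _).
  apply: pb_uniq; rewrite !pbE -?compA ?pbE //.
by rewrite /= /Frho -compA !pbE (reassoc mu1) -compA !pbE.
Qed.

(** For a path p from a to b and paths q : a -> a', q' : b -> b', transport yields the inverse of q,
    then p, then q': [mu] appends q' and [nu] prepends the inverse of q. *)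
Lemma endpoints_alg_of_Moore (X : C) : Moore_relation_system R ->
  D (pair (Defs.eps R false X) (Defs.eps R true X)).
Proof.
move=> [tr _ sy]; set ep := pair _ _.
have [mu [mu0 mu1 mu_unit]] := tr X.
have [nu [nu0 nu1 nu_unit]] := sy X.
have sq := pb_comm ep (Defs.eps R false (prd X X)).
have e1 : eps true \o pb1 ep (eps false) =
    eps false \o (Psimap (pr2 X X) \o pb2 ep (eps false)).
  rewrite (reassoc (eps_Psimap _ _ _)) -compA -sq /ep.
  by rewrite (reassoc (pr2_pair _ _)).
have e2 : eps false \o (Psimap (pr1 X X) \o pb2 ep (eps false)) =
    eps false \o (mu \o pbpair _ _ e1).
  rewrite (reassoc mu0) -compA !pbE (reassoc (eps_Psimap _ _ _)) -compA -sq /ep.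
  by rewrite (reassoc (pr1_pair _ _)).
apply/algP; exists (nu \o pbpair _ _ e2); split.
  rewrite -[RHS]nu_unit -compA; congr (_ \o _).
  apply: pb_uniq; rewrite /unit_pair !pbE -!compA ?pbE.
    by rewrite (reassoc (Psimap_eta _ _)) /ep -compA pr1_pair.
  rewrite -[RHS]mu_unit; congr (_ \o _).
  apply: pb_uniq; rewrite !pbE -?compA ?pbE //.
  by rewrite (reassoc (Psimap_eta _ _)) /ep -compA pr2_pair.
apply: pair_uniq; rewrite /ep pairC ?pr1_pair ?pr2_pair.
  by rewrite (reassoc nu0) -compA !pbE !compA eps_Psimap.
rewrite (reassoc nu1) -compA !pbE (reassoc mu1) -compA !pbE.
by rewrite !compA eps_Psimap.
Qed.

End Relation.

Theorem theorem5p7 (C : finCompleteCategory) (R : relation_on C) :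
  Id_presentation R <-> Moore_relation_system R.
Proof.
split=> [[wfs id_alg]|moore].
  have ends X := proj1 (id_alg X).
  split; first exact: transitive_of_wfs.
    exact: homotopical_of_wfs.
  exact: symmetric_of_wfs.
have wfs := wfs_of_Moore moore.
have ends X := endpoints_alg_of_Moore X moore.
split=> // X; split=> // A a i; exact: unit_pair_LLP.
Qed.
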